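(* Let $\mathbb{P}$ be a translation-invariant Borel probability measure on $\Omega=[0,\infty)^{\mathbb{Z}^2}$. Let $m\in\mathbb{N}=\{1,2,\ldots\}$ and let $A\subset\mathbb{T}$ be a subset satisfying the growth property (such that the events $\{\mathcal{T}_{(m,1)}\in A\}$ and $\{\mathcal{T}_{(1,1)}\in A\}$ are measurable). For $k\in\mathbb{N}$ set $$\Omega_k=\left\{\omega\in\Omega : \gamma_{(k,1)}^\omega=\left((0,0),(1,0),\ldots,(k,0),(k,1)\right)\right\}.$$ Then $$\mathbb{P}\left(\{\mathcal{T}_{(m,1)}\in A\}\cap\Omega_m\right)\le \mathbb{P}\left(\{\mathcal{T}_{(1,1)}\in A\}\cap\Omega_1\right).$$
   Context: $\mathbb{Z}_+=\{0,1,2,\ldots\}$. $\Omega=[0,\infty)^{\mathbb{Z}^2}$ is the configuration space, with its Borel $\sigma$-algebra for the product topology. For $a\in\mathbb{Z}^2$, the translation $\tau_a:\Omega\to\Omega$ is $\tau_a(\omega)=\omega(a+\cdot)$. $\mathbb{P}$ is translation-invariant if $\mathbb{P}=\mathbb{P}\circ\tau_a^{-1}$ for all $a\in\mathbb{Z}^2$. Paths: a path is a (finite or infinite) sequence $\gamma=(z_0,z_1,\ldots)$ of sites of $\mathbb{Z}^2$ with $z_{i+1}-z_i\in\{(1,0),(0,1)\}$. Its length for $\omega\in\Omega$ is $\omega(\gamma)=\sum_{z\in\gamma}\omega(z)$. For $z\in\mathbb{Z}_+^2$, $\Gamma_z$ is the finite set of paths from $(0,0)$ to $z$; $\gamma\in\Gamma_z$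 is $\omega$-optimal if $\omega(\gamma)$ is maximal over $\Gamma_z$. For two paths in $\Gamma_z$, $\gamma$ is below $\gamma'$ if at each step the second coordinate of the site of $\gamma$ is at most that of the corresponding site of $\gamma'$. The low-optimal path $\gamma_z^\omega$ is the unique $\omega$-optimal path of $\Gamma_z$ lying below all other $\omega$-optimal paths of $\Gamma_z$ (it always exists). Trees: the last passage percolation tree $\mathcal{T}^\omega$ is the collection of all low-optimal paths $\gamma_z^\omega$, $z\in\mathbb{Z}_+^2$, viewed as a tree rooted at $(0,0)$ with vertex set $\mathbb{Z}_+^2$ (each $u\neq(0,0)$ is joined to the site preceding it on $\gamma_u^\omega$). For $z\in\mathbb{Z}_+^2$, $\mathcal{T}_z^\omega$ is the subtree of $\mathcal{T}^\omega$ rooted at $z$; its vertex set is $\{u\in\mathbb{Z}_+^2 : z\in\gamma_u^\omega\}$. $\mathcal{T}_z$ denotes the random tree $\omega\mapsto\mathcal{T}_z^\omega$. Set $\mathbb{T}=\{\mathcal{T}_z^\omega : z\in\mathbb{Z}_+^2,\ \omega\in\Omega\}$. For $T\in\mathbb{T}$, $r(T)$ is its root, $V(T)$ its vertex set, and $V(T)-r(T)=\{v-r(T): v\in V(T)\}$ is the vertex set translated so that the root is at the origin. Growth property: a subset $A\subset\mathbb{T}$ satisfies the growth property if, whenever $T\in A$, $T'\in\mathbb{T}$ and $V(T)-r(T)\subset V(T')-r(T')$, one has $T'\in A$. *)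

(* Defs.v *)
From HB Require Import structures.
From mathcomp Require Import all_boot all_order all_algebra.
From mathcomp Require Import all_classical all_reals all_analysis.
Import Order.TTheory GRing.Theory Num.Theory.
Import numFieldNormedType.Exports.

Set Implicit Arguments.
Unset Strict Implicit.
Unset Printing Implicit Defensive.

Local Open Scope classical_set_scope.
Local Open Scope ring_scope.

Notation site := (int * int)%type.

Definition quadrant : set site := [set z | 0 <= z.1 /\ 0 <= z.2].

(* Half-line [0, oo[ with the topology induced from R, and the configuration
   space [0, oo[^(Z^2) with the product topology and its Borel sigma-algebra. *)
Definition halfline (R : realType) : set R := [set x | 0 <= x].
Arguments halfline : clear implicits.

Definition Omega (R : realType) : Type :=
  prod_topology (fun _ : site => set_type (halfline R)).

HB.instance Definition _ (R : realType) := Topological.copy (Omega R)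
  (prod_topology (fun _ : site => set_type (halfline R))).

HB.instance Definition _ (R : realType) := isPointed.Build (Omega R)
  (fun _ => exist _ 0 (mem_set (lexx 0 : halfline R 0))).

HB.instance Definition _ (R : realType) := Measurable.copy (Omega R)
  (g_sigma_algebraType (@open (Omega R))).

Definition weight (R : realType) (w : Omega R) (z : site) : R := set_val (w z).

Definition translation (R : realType) (a : site) (w : Omega R) : Omega R :=
  fun z => w (a + z).

Definition translation_invariant (R : realType)
    (P : probability (Omega R) R) : Prop :=
  forall (a : site) (B : set (Omega R)), measurable B ->
    P (translation a @^-1` B) = P B.

(* A finite path is the sequence of its sites, both endpoints included. *)
Definition step : rel site :=
  [rel x y | (y - x == (1, 0)) || (y - x == (0, 1))].

Definition paths_to (z : site) : set (seq site) :=
  [set g | exists s, [/\ g = 0 :: s, path step 0 s & last 0 s = z]].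

Section LastPassage.
Variables (R : realType) (w : Omega R).

Definition path_length (g : seq site) : R := \sum_(z <- g) weight w z.

Definition optimal (z : site) : set (seq site) :=
  [set g | paths_to z g /\
           forall g', paths_to z g' -> path_length g' <= path_length g].

Definition below (g g' : seq site) : bool :=
  all2 (fun x y : site => x.2 <= y.2) g g'.

(* For z in the quadrant exactly one path satisfies the condition; the default
   value [::] is taken only outside the quadrant, where paths_to z is empty. *)
Definition low_optimal_path (z : site) : seq site :=
  xget [::] [set g | optimal z g /\ forall g', optimal z g' -> below g g'].

End LastPassage.

(* Rooted trees on sites; an edge is the pair (parent, child). Edges are part
   of the data since they are not determined by the root and the vertex set. *)
Record rooted_tree := RootedTree {
  root : site;
  vertices : set site;
  edges : set (site * site) }.

Definition lpp_tree (R : realType) (w : Omega R) : rooted_tree :=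
  {| root := 0;
     vertices := quadrant;
     edges := [set e | quadrant e.2 /\
       exists s, low_optimal_path w e.2 = rcons (rcons s e.1) e.2] |}.

Definition lpp_subtree_vertices (R : realType) (w : Omega R) (z : site) :
  set site := [set u | quadrant u /\ z \in low_optimal_path w u].

Definition lpp_subtree (R : realType) (w : Omega R) (z : site) : rooted_tree :=
  {| root := z;
     vertices := lpp_subtree_vertices w z;
     edges := edges (lpp_tree w) `&`
       (lpp_subtree_vertices w z `*` lpp_subtree_vertices w z) |}.

Definition lpp_subtrees (R : realType) : set rooted_tree :=
  [set T | exists (z : site) (w : Omega R), quadrant z /\ T = lpp_subtree w z].

Definition centered_vertices (T : rooted_tree) : set site :=
  [set v - root T | v in vertices T].

Definition growth_property (R : realType) (A : set rooted_tree) : Prop :=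
  forall T T', A T -> lpp_subtrees R T' ->
    centered_vertices T `<=` centered_vertices T' -> A T'.

Definition tree_event (R : realType) (A : set rooted_tree) (z : site) :
  set (Omega R) := [set w | A (lpp_subtree w z)].
Arguments tree_event : clear implicits.

(* The path (0,0), (1,0), ..., (k,0), (k,1). *)
Definition axis_path (k : nat) : seq site :=
  rcons [seq (i%:Z, 0) | i <- iota 0 k.+1] (k%:Z, 1).

Definition Omega_axis (R : realType) (k : nat) : set (Omega R) :=
  [set w | low_optimal_path w (k%:Z, 1) = axis_path k].
Arguments Omega_axis : clear implicits.

(* Main.v *)
(* On [Omega_axis m], every low-optimal path through [(m, 1)] starts with the
   axis path, because an initial segment of a low-optimal path is low-optimal.
   A final segment of a low-optimal path is low-optimal for the translated
   configuration.  Cutting at [a = (m - 1, 0)] therefore shows that [translation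
   a] sends [Omega_axis m] into [Omega_axis 1] and can only enlarge the centered
   subtree, so that the first event lies in the preimage of the second one. *)
Require Import Defs.
From mathcomp Require Import all_boot all_order all_algebra.
From mathcomp Require Import all_classical all_reals all_analysis.
From mathcomp Require Import zify.
Import Order.TTheory GRing.Theory Num.Theory.
Import numFieldNormedType.Exports.

Set Implicit Arguments.
Unset Strict Implicit.
Unset Printing Implicit Defensive.

Local Open Scope classical_set_scope.
Local Open Scope ring_scope.

(** * Combinatorics of up-right lattice paths *)

Lemma all2_cat (S T : Type) (r : S -> T -> bool) (s1 s2 : seq S)
    (t1 t2 : seq T) : size s1 = size t1 ->
  all2 r (s1 ++ s2) (t1 ++ t2) = all2 r s1 t1 && all2 r s2 t2.
Proof. by elim: s1 t1 => [|x s1 IH] [|y t1] //= [/IH->]; rewrite andbA. Qed.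

Lemma stepP (x y : site) : step x y ->
  y.1 = x.1 + 1 /\ y.2 = x.2 \/ y.1 = x.1 /\ y.2 = x.2 + 1.
Proof.
case: x y => x1 x2 [y1 y2] /orP[] /eqP[/= e1 e2]; [left|right]; split; lia.
Qed.

Lemma step_translate (a : site) : {mono +%R a : x y / step x y}.
Proof. by move=> x y; rewrite /step /= opprD addrACA subrr add0r. Qed.

Section Paths.
Implicit Types (x y z a v : site) (g p q : seq site).

(** Final segments do not start at the origin; [paths_to z] is the case [x = 0], by conversion. *)
Definition path_between x z g :=
  exists s, [/\ g = x :: s, path step x s & last x s = z].

Lemma path_between_rcons x y g : path_between x y g -> exists t, g = rcons t y.
Proof. by move=> [s [-> _ <-]]; exists (belast x s); rewrite lastI. Qed.

Lemma path_between_cat x y z p q : path_between x y (rcons p y) ->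
  path_between y z (y :: q) -> path_between x z (p ++ y :: q).
Proof.
move=> [s [ps xs ly]] [_ [[<-] yq lz]]; exists (s ++ q).
by rewrite -cat_rcons ps cat_path xs last_cat ly.
Qed.

Lemma path_between_split x y z p q : path_between x z (p ++ y :: q) ->
  path_between x y (rcons p y) /\ path_between y z (y :: q).
Proof.
case: p => [|x' p] [s []] /= [-> <-].
  by move=> yq lz; split; [exists [::]|exists q].
rewrite cat_path last_cat /= => /and3P[xp py yq] lz.
split; [exists (rcons p y)|by exists q].
by rewrite rcons_path xp py last_rcons.
Qed.

Lemma path_between_translate a x z g :
  path_between x z g -> path_between (a + x) (a + z) (map (+%R a) g).
Proof.
move=> [s [-> xs <-]]; exists (map (+%R a) s); split => //.
  by rewrite (mono_path (step_translate a)).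
by rewrite last_map.
Qed.

(** Each step raises the sum of the coordinates by one. Hence paths with the same endpoints have
    equal size and can be compared segment by segment. *)
Lemma path_between_size x z g : path_between x z g ->
  (size g)%:Z = z.1 - x.1 + (z.2 - x.2) + 1.
Proof.
move=> [s [-> + <-]]; elim: s x => [|y s IH] x /=; first lia.
by move=> /andP[/stepP xy /IH /=]; lia.
Qed.

Lemma path_between_ge x z g v : path_between x z g -> v \in g ->
  x.1 <= v.1 /\ x.2 <= v.2.
Proof.
move=> [s [-> + _]]; elim: s x => [|y s IH] x /=.
  by rewrite inE => _ /eqP->.
move=> /andP[/stepP xy /IH{}IH]; rewrite inE.
by move=> /orP[/eqP-> //|/IH[? ?]]; split; lia.
Qed.

(** From a common site, the height after one step determines which step was taken. *)
Lemma below_anti x z z' g g' : path_between x z g -> path_between x z' g' ->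
  below g g' -> below g' g -> g = g'.
Proof.
move=> [s [-> + _]] [s' [-> + _]] /= /andP[_ +] /andP[_ +].
elim: s s' x => [|y s IH] [|y' s'] x //=.
move=> /andP[/stepP xy ys] /andP[/stepP xy' ys'] /andP[yy' ss'] /andP[y'y s's].
have yE : y = y'.
  by move: xy xy' yy' y'y; case: y {ys} y' {ys'} => [? ?] [? ?] /= *;
     congr pair; lia.
by rewrite -yE in ys' *; case: (IH s' y ys ys' ss' s's) => ->.
Qed.

Lemma below_translate a g g' :
  below (map (+%R a) g) (map (+%R a) g') = below g g'.
Proof.
by elim: g g' => [|x g IH] [|y g'] //=; rewrite lerD2l IH.
Qed.

(** The axis path has height 0 up to its last site, which is the common endpoint. *)
Lemma axis_path_below k g : paths_to (k%:Z, 1) g -> below (axis_path k) g.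
Proof.
move=> kg; have gge0 v : v \in g -> 0 <= v.2 by move=> /(path_between_ge kg)[].
have [t gE] := path_between_rcons kg.
have sz : (size t).+1%:Z = k%:Z + 2.
  by have := path_between_size kg; rewrite gE size_rcons /=; lia.
rewrite gE in gge0 *.
rewrite /axis_path -!cats1 [below _ _]all2_cat; last first.
  by rewrite size_map size_iota; lia.
apply/andP; split; last by [].
have {sz}sz : size t = k.+1 by lia.
have {gge0} : all (fun v : site => 0 <= v.2) t.
  by apply/allP => v vt; apply: gge0; rewrite mem_rcons inE vt orbT.
(* The start of [iota] is generalized with its length, since the tail begins at the next index. *)
elim: t k.+1 0%N sz {gE kg} => [|v t IH] [|n] i //= [/IH{}IH].
by move=> /andP[-> /IH->].
Qed.

End Paths.

(** * Segments of low-optimal paths *)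

Section Optimal.
Variable R : realType.
Implicit Types (w : Omega R) (x y z a : site) (g p q : seq site).

Lemma path_length_cat w p q :
  path_length w (p ++ q) = path_length w p + path_length w q.
Proof. exact: big_cat. Qed.

Lemma path_length_translation a w g :
  path_length (translation a w) g = path_length w (map (+%R a) g).
Proof. by rewrite /path_length big_map. Qed.

Definition low_optimal w z : set (seq site) :=
  [set g | optimal w z g /\ forall g', optimal w z g' -> below g g'].

Lemma low_optimal_unique w z g g' :
  low_optimal w z g -> low_optimal w z g' -> g = g'.
Proof.
move=> [og lg] [og' lg'].
case: (og) (og') => pg _ [pg' _].
exact: below_anti pg pg' (lg _ og') (lg' _ og).
Qed.

Lemma low_optimal_pathE w z g : low_optimal w z g -> low_optimal_path w z = g.
Proof. by move=> lg; apply: xget_unique => // y /low_optimal_unique; apply. Qed.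

(** The default of [xget] is [[::]], so any other value was chosen from the set. *)
Lemma low_optimal_pathP w z :
  low_optimal_path w z <> [::] -> low_optimal w z (low_optimal_path w z).
Proof. by rewrite /low_optimal_path; case: xgetP. Qed.

(** Exchange argument: a competitor to [y] followed by [q] competes with the whole path, and the
    contribution of [q] cancels. *)
Lemma low_optimal_prefix w y z p q :
  low_optimal w z (p ++ y :: q) -> low_optimal w y (rcons p y).
Proof.
move=> [[zpq mpq] lpq]; have [yp zq] := path_between_split zpq.
have ext g : paths_to y g -> paths_to z (g ++ q).
  move=> yg; have [t gE] := path_between_rcons yg.
  by rewrite gE cat_rcons; apply: path_between_cat zq; rewrite -gE.
split.
  split=> // g /ext/mpq; rewrite -cat_rcons !path_length_cat.
  by rewrite lerD2r.
(* An optimal initial segment extends to an optimal path, so the whole path lies below that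
   extension. *)
move=> g [yg mg]; have /lpq : optimal w z (g ++ q).
  split; first exact: ext.
  move=> g' /mpq/le_trans; apply; rewrite -cat_rcons !path_length_cat lerD2r.
  exact: mg.
rewrite -cat_rcons [below _ _]all2_cat => [/andP[]//|].
by have := path_between_size yp; rewrite -(path_between_size yg) => -[].
Qed.

(** The same exchange with [p] kept fixed: lengths for [translation a w] are lengths for [w] along
    the path shifted by [a]. *)
Lemma low_optimal_suffix w a z p q :
  low_optimal w (a + z) (p ++ map (+%R a) (0 :: q)) ->
  low_optimal (translation a w) z (0 :: q).
Proof.
rewrite /= addr0 => -[[zpq mpq] lpq]; have [ap aq] := path_between_split zpq.
have ext g : paths_to z g -> paths_to (a + z) (p ++ map (+%R a) g).
  move=> /(path_between_translate a); rewrite addr0 => -[s [-> sp sl]].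
  by apply: path_between_cat ap _; exists s.
have zq : paths_to z (0 :: q).
  have := path_between_translate (- a) aq; rewrite addKr addNr /=.
  by rewrite addNr mapK //; exact: addKr.
split.
  split=> // g zg; have := mpq _ (ext _ zg); rewrite !path_length_cat lerD2l.
  by rewrite !path_length_translation /= addr0.
move=> g [zg mg]; have /lpq : optimal w (a + z) (p ++ map (+%R a) g).
  split; first exact: ext.
  move=> g' /mpq/le_trans; apply; rewrite !path_length_cat lerD2l.
  rewrite -path_length_translation; apply: le_trans (mg _ zq).
  by rewrite path_length_translation /= addr0.
rewrite [below _ _]all2_cat // => /andP[_].
by have := below_translate a (0 :: q) g; rewrite /= addr0 => <-.
Qed.

End Optimal.

(** * Borel measurability of translations and optimality *)

Section Measurability.
Variable R : realType.

Lemma closed_measurable_Omega (B : set (Omega R)) : closed B -> measurable B.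
Proof.
move=> /closed_openC oB; rewrite -[B]setCK; apply: measurableC.
exact: sub_sigma_algebra.
Qed.

Lemma coordinate_continuous (z : site) : continuous (fun w : Omega R => w z).
Proof.
exact: (@proj_continuous _ (fun _ : site => set_type (halfline R)) z).
Qed.

Lemma weight_continuous (z : site) : continuous (fun w : Omega R => weight w z).
Proof.
move=> w; apply: (@continuous_comp _ _ _ (fun w : Omega R => w z)
  (set_val : set_type (halfline R) -> R)); first exact: coordinate_continuous.
exact: initial_continuous.
Qed.

Lemma path_length_continuous (g : seq site) :
  continuous (fun w : Omega R => path_length w g).
Proof.
apply: continuous_big => [|z _]; first exact: add_continuous.
exact: weight_continuous.
Qed.

Lemma translation_continuous (a : site) : continuous (@translation R a).
Proof.
move=> w.
have FF := @fmap_filter _ _ (@translation R a) (nbhs w) (nbhs_filter w).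
(* The product topology is a supremum of initial topologies, so one coordinate [z] is treated at a
   time; after translation it reads coordinate [a + z]. *)
apply/cvg_sup => z U [V [[W oW <-] /= Ww WU]].
have Wa : nbhs w ((fun w' : Omega R => w' (a + z)) @^-1` W).
  by apply: coordinate_continuous; exact: open_nbhs_nbhs.
by apply: filterS Wa => w'; exact: (WU (translation a w')).
Qed.

Lemma translation_measurable (a : site) (B : set (Omega R)) :
  measurable B -> measurable (translation a @^-1` B).
Proof.
have mtr : measurable_fun setT (@translation R a).
  apply: (measurability (@open (Omega R))) => // _ [U oU <-].
  apply: sub_sigma_algebra; rewrite setTI.
  by move/continuousP: (@translation_continuous a); apply.
by move=> mB; rewrite -[X in measurable X]setTI; exact: mtr.
Qed.

(** The set is closed: each competing path imposes a weak inequality between continuous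
    functions. *)
Lemma optimal_measurable (z : site) (g : seq site) :
  measurable [set w : Omega R | optimal w z g].
Proof.
have [zg|nzg] := pselect (paths_to z g); last first.
  rewrite (_ : mkset _ = set0) //.
  by apply/seteqP; split=> w // -[].
rewrite (_ : mkset _ = \bigcap_(g' in paths_to z)
  (fun w : Omega R => path_length w g - path_length w g') @^-1`
    [set x | 0 <= x]).
  apply: closed_measurable_Omega; apply: closed_bigI => g' _.
  apply: preimage_closed; last exact: closed_ge.
  by move=> w _; apply: continuousB; apply: path_length_continuous.
apply/seteqP; split=> [w [_ mg] g' /mg|w mg]; first by rewrite /= subr_ge0.
by split=> // g' /mg; rewrite /= subr_ge0.
Qed.
End Measurability.

(** * Axis paths and the shift by [(m, 0)] *)

Section AxisPaths.
Variable R : realType.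
Implicit Types (w : Omega R) (u : site).

Lemma Omega_axisP w k :
  Omega_axis R k w <-> low_optimal w (k%:Z, 1) (axis_path k).
Proof.
split=> [wk|]; last exact: low_optimal_pathE.
rewrite -[X in low_optimal _ _ X]wk; apply: low_optimal_pathP.
by rewrite [low_optimal_path _ _]wk; case: k {wk}.
Qed.

(** The axis path lies below every competitor, so optimality alone makes it low-optimal; this
    reduces measurability to that of optimality. *)
Lemma Omega_axisE k :
  Omega_axis R k = [set w | optimal w (k%:Z, 1) (axis_path k)].
Proof.
apply/seteqP; split=> w; first by move=> /Omega_axisP[].
move=> ok; apply/Omega_axisP; split=> // g' [kg' _].
exact: axis_path_below.
Qed.

Lemma axis_pathS m : axis_path m.+1 =
  [seq (i%:Z, 0) | i <- iota 0 m] ++ map (+%R (m%:Z, 0)) (axis_path 1).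
Proof.
rewrite /axis_path -[m.+2]addn2 iotaD map_cat rcons_cat /= !add0n; congr cat.
have -> : m.+1%:Z = m%:Z + 1 by lia.
by rewrite /+%R /= /add_pair /= !addr0 add0r.
Qed.

Lemma low_optimal_axis w m u q : low_optimal w u (axis_path m.+1 ++ q) ->
  low_optimal (translation (m%:Z, 0) w) (u - (m%:Z, 0))
    (axis_path 1 ++ map (+%R (- (m%:Z, 0))) q).
Proof.
rewrite axis_pathS -catA.
(* Both [q] and [u] are written as shifts by [(m, 0)] of their shifts back, the shape that
   [low_optimal_suffix] expects. *)
rewrite -[in X in low_optimal w u X](mapK (addNKr (m%:Z, 0)) q).
rewrite -map_cat -{1}[u](subrK (m%:Z, 0)) addrC.
exact: low_optimal_suffix.
Qed.

Lemma Omega_axis_translation w m : Omega_axis R m.+1 w ->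
  Omega_axis R 1 (translation (m%:Z, 0) w).
Proof.
move=> /Omega_axisP; rewrite -[axis_path _]cats0 => /low_optimal_axis /=.
rewrite (_ : _ - _ = (1%:Z, 1)) => [?|]; first exact/Omega_axisP.
by congr pair; rewrite /=; lia.
Qed.

Lemma centered_vertices_translation w m : Omega_axis R m.+1 w ->
  centered_vertices (lpp_subtree w (m.+1%:Z, 1)) `<=`
  centered_vertices (lpp_subtree (translation (m%:Z, 0) w) (1, 1)).
Proof.
(* The shift takes the root [(m + 1, 1)] to [(1, 1)], so the centered site is unchanged. *)
move=> /Omega_axisP wm _ [u [_ mu] <-] /=; exists (u - (m%:Z, 0)); last first.
  by rewrite -addrA -opprD; congr (u - _); congr pair; rewrite /=; lia.
have lu : low_optimal w u (low_optimal_path w u).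
  by apply: low_optimal_pathP => u0; rewrite u0 in mu.
case/splitPr: mu lu => p q lu.
(* By uniqueness the path to [u] begins with the axis path. *)
have pE := low_optimal_unique (low_optimal_prefix lu) wm.
rewrite -cat_rcons pE in lu.
have {}lu := low_optimal_axis lu; split; last first.
  by rewrite (low_optimal_pathE lu) !inE eqxx !orbT.
(* The shifted site ends a path from the origin, hence lies in the quadrant. *)
case: lu => -[[s [_ us uE]] _] _; rewrite -uE.
have us' : path_between 0 (last 0 s) (0 :: s) by exists s.
by have [] := path_between_ge us' (mem_last 0 s).
Qed.

End AxisPaths.

(** * Comparison of the two events by invariance *)

Theorem theorem3 (R : realType) (P : probability (Omega R) R)
    (P_inv : translation_invariant P)
    (m : nat) (m_gt0 : (0 < m)%N)
    (A : set rooted_tree)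
    (A_sub : A `<=` lpp_subtrees R)
    (A_growth : growth_property R A)
    (A_meas_m : measurable (tree_event R A (m%:Z, 1)))
    (A_meas_1 : measurable (tree_event R A (1, 1))) :
  (P (tree_event R A (m%:Z, 1)%R `&` Omega_axis R m) <=
   P (tree_event R A (1, 1)%R `&` Omega_axis R 1))%E.
Proof.
have mI (k : nat) : measurable (tree_event R A (k%:Z, 1)) ->
    measurable (tree_event R A (k%:Z, 1) `&` Omega_axis R k).
  move=> mk; apply: measurableI => //; rewrite Omega_axisE.
  exact: optimal_measurable.
(* From here on [m] stands for the original [m] minus one, so the shift is by [(m, 0)]. *)
case: m m_gt0 A_meas_m => // m _ A_meas_m.
rewrite -(P_inv (m%:Z, 0) _ (mI 1%N A_meas_1)).
apply: le_measure; rewrite ?inE; first exact: mI.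
  by apply: translation_measurable; exact: (mI 1%N).
move=> w [Aw wm]; split; last exact: Omega_axis_translation.
(* The larger tree is a subtree for the translated configuration, as the growth property
   requires. *)
apply: A_growth Aw _ (centered_vertices_translation wm).
by exists (1, 1), (translation (m%:Z, 0) w).
Qed.
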